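(* Let $d\geq1$ be an integer, let $\alpha>\frac d2$ and $\beta>\alpha$ be fixed, and let $b>0$. As $a$ and $\gamma$ tend to infinity in such a way that $\frac{a}{\sqrt\gamma}$ tends to $b$, the Gauss hypergeometric covariance $G_d(\cdot;a,\alpha,\beta,\gamma)$ converges uniformly on $\mathbb{R}^d$ to the covariance kernel $$\boldsymbol h\mapsto\frac{\Gamma(\beta-\frac d2)}{\Gamma(\alpha-\frac d2)}\,L\left(\frac d2-\beta+1,\frac d2-\alpha+1,\frac{\|\boldsymbol h\|^2}{b^2}\right),\qquad\boldsymbol h\in\mathbb{R}^d,$$ where $L$ is the Laguerre function of the second kind. The same result holds by interchanging $\beta$ and $\gamma$.
   Context: For $a>0$, $\alpha>\frac d2$, $\beta>\alpha$, $\gamma>\alpha$, the Gauss hypergeometric covariance is $$G_d(\boldsymbol h;a,\alpha,\beta,\gamma)=\frac{\Gamma(\beta-\frac d2)\Gamma(\gamma-\frac d2)}{\Gamma(\beta-\alpha+\gamma-\frac d2)\Gamma(\alpha-\frac d2)}\left(1-\frac{\|\boldsymbol h\|^2}{a^2}\right)_+^{\beta-\alpha+\gamma-\frac d2-1}{}_2F_1\left(\beta-\alpha,\gamma-\alpha;\beta-\alpha+\gamma-\tfrac d2;\left(1-\tfrac{\|\boldsymbol h\|^2}{a^2}\right)_+\right),\quad\boldsymbol h\in\mathbb{R}^d,$$ where $(x)_+=\max\{x,0\}$ and ${}_2F_1$ is the Gauss hypergeometric function. The Laguerre function of the second kind is defined, for real parameters $\mu<\nu$ and $x\geq0$ (whenever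 the integral converges), by $$L(\mu,\nu,x)=\frac{1}{\Gamma(\nu-\mu)}\int_1^{+\infty}\exp(-u\,x)\,u^{\mu-1}(u-1)^{\nu-\mu-1}\,du.$$ ''Covariance kernel'' in $\mathbb{R}^d$ means positive semidefinite function $\boldsymbol h\mapsto C(\boldsymbol h)$. *)

(* Defs.v *)
From HB Require Import structures.
From mathcomp Require Import all_boot all_order all_algebra.
From mathcomp Require Import all_classical all_reals all_analysis.

Set Implicit Arguments.
Unset Strict Implicit.
Unset Printing Implicit Defensive.

Import Order.TTheory GRing.Theory Num.Theory.
Import numFieldNormedType.Exports.

Local Open Scope classical_set_scope.
Local Open Scope ring_scope.

(* The canonical norm `|h| on 'rV_d is the sup norm, hence this definition. *)
Definition euclidean_norm (R : realType) (d : nat) (h : 'rV[R]_d) : R :=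
  Num.sqrt (\sum_(i < d) h 0 i ^+ 2).

(* Euler's integral; it represents Gamma for z > 0 only. *)
Definition Gamma (R : realType) (z : R) : R :=
  \int[@lebesgue_measure R]_(t in `]0, +oo[) (t `^ (z - 1) * expR (- t)).

Definition rising_factorial (R : realType) (x : R) (n : nat) : R :=
  \prod_(i < n) (x + i%:R).

(* The Gauss series. It is the hypergeometric function where it converges: for
   c not a nonpositive integer, on |x| < 1, and at x = 1 if c - a - b > 0. *)
Definition hypergeometric_2F1 (R : realType) (a b c x : R) : R :=
  limn (series (fun n : nat =>
    rising_factorial a n * rising_factorial b n / rising_factorial c n
      * (x ^+ n / n`!%:R))).

(* Since 0 `^ p = 0 for p != 0 and 0 `^ 0 = 1, the value outside the ball of
   radius a is 0 unless the exponent vanishes. *)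
Definition gauss_hypergeometric_covariance (R : realType) (d : nat)
    (a alpha beta gamma : R) (h : 'rV[R]_d) : R :=
  let d2 := d%:R / 2 in
  let x := Num.max (1 - euclidean_norm h ^+ 2 / a ^+ 2) 0 in
  Gamma (beta - d2) * Gamma (gamma - d2)
    / (Gamma (beta - alpha + gamma - d2) * Gamma (alpha - d2))
  * x `^ (beta - alpha + gamma - d2 - 1)
  * hypergeometric_2F1 (beta - alpha) (gamma - alpha)
      (beta - alpha + gamma - d2) x.

(* Meaningful when mu < nu and the integral converges. *)
Definition laguerre_second_kind (R : realType) (mu nu x : R) : R :=
  (Gamma (nu - mu))^-1 *
  \int[@lebesgue_measure R]_(u in `]1, +oo[)
     (expR (- (u * x)) * u `^ (mu - 1) * (u - 1) `^ (nu - mu - 1)).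

Definition laguerre_kernel (R : realType) (d : nat) (b alpha beta : R)
    (h : 'rV[R]_d) : R :=
  let d2 := d%:R / 2 in
  Gamma (beta - d2) / Gamma (alpha - d2)
  * laguerre_second_kind (d2 - beta + 1) (d2 - alpha + 1)
      (euclidean_norm h ^+ 2 / b ^+ 2).

(* Positive semidefiniteness with real coefficients; evenness, automatic with
   complex coefficients, has to be required separately. *)
Definition covariance_kernel (R : realType) (d : nat) (C : 'rV[R]_d -> R)
    : Prop :=
  (forall h, C (- h) = C h) /\
  (forall (n : nat) (s : 'I_n -> 'rV[R]_d) (w : 'I_n -> R),
     0 <= \sum_(i < n) \sum_(j < n) w i * w j * C (s i - s j)).

(* Main.v *)
(* Put A = alpha - d/2, B = beta - d/2, s = beta - alpha and
   w(v) = v^(s-1) (1+v)^(-B) on v > 0, whose integral is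
   Gamma(A) Gamma(s) / Gamma(B). Both functions are mixtures with the same
   weight kappa w, kappa = Gamma(B) / (Gamma(A) Gamma(s)):
     limit kernel    exp(-(1+v) r^2/b^2),
     covariance      x^N (1 + (1-x) v)^(-(gamma-alpha)),
   where r = ||h||, x = (1 - r^2/a^2)_+ and N = beta - alpha + gamma - d/2 - 1.
   The second identity is Euler's integral for 2F1 after t = v/(1+v). As
   kappa w dv is a probability measure, uniform convergence reduces to the
   elementary uniform limits (1-y)_+^n - e^(-ny) -> 0 and
   (1+y)^(-n) - e^(-ny) -> 0 on y >= 0, and positive semidefiniteness to that of
   the Gaussian kernel. *)
Require Import Defs.
From HB Require Import structures.
From mathcomp Require Import all_boot all_order all_algebra.
From mathcomp Require Import all_classical all_reals all_analysis.
From mathcomp Require Import measurable_realfun.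
From mathcomp Require Import ring lra.

Import Order.TTheory GRing.Theory Num.Theory.
Import numFieldNormedType.Exports.

Local Open Scope classical_set_scope.
Local Open Scope ring_scope.

Local Notation mu := (@lebesgue_measure _).

(** * Affine change of variables *)

Lemma preimage_affine_itv (R : realType) (c t : R) (a b : itv_bound R) : 0 < c ->
  (fun x => c * x + t) @^-1` [set` Interval a b] =
  let g (u : itv_bound R) := match u with
    | BSide p x => BSide p ((x - t) / c)
    | BInfty p => BInfty R p
    end in
  [set` Interval (g a) (g b)].
Proof.
move=> c0; case: a b => [[] a|[]] [[] b|[]]; apply/seteqP; split => x;
  rewrite /= !in_itv /= ?andbT ?andbF //; move: c0;
  do ?[move=> c0 /andP[+ +]; rewrite ?ler_pdivrMr ?ler_pdivlMr
    ?ltr_pdivrMr ?ltr_pdivlMr // => ? ?; apply/andP; split; lra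
  | move=> c0; rewrite ?ler_pdivrMr ?ler_pdivlMr ?ltr_pdivrMr ?ltr_pdivlMr //; lra].
Qed.

(** Lebesgue measure is [c] times its pushforward under x -> c x + t: the two measures agree on
    bounded intervals, and Lebesgue measure is determined by its values there. *)
Lemma ge0_integral_affine (R : realType) (c t : R) (D : set R) (f : R -> \bar R) :
  0 < c -> measurable D -> measurable_fun D f -> (forall x, D x -> 0 <= f x)%E ->
  (\int[mu]_(x in D) f x =
   c%:E * \int[mu]_(x in (fun x => (c * x + t)%R) @^-1` D) f (c * x + t)%R)%E.
Proof.
move=> c0 mD mf f0.
pose phi := (fun x : measurableTypeR R => c * x + t : measurableTypeR R).
have mphi : measurable_fun setT phi.
  by apply: measurable_funD => //; exact: measurable_funM.
pose mphi_mixin := isMeasurableFun.Build _ _ _ _ _ mphi.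
pose mphi_pack : {mfun _ >-> _} := HB.pack phi mphi_mixin.
rewrite -[X in (_ * X)%E]/(\int[mu]_(x in phi @^-1` D) (f \o phi) x)%E.
rewrite -(ge0_integral_pushforward mphi) //; last by move=> y /[!inE]; exact: f0.
have c0' : 0 <= c by exact: ltW.
rewrite -(@ge0_integral_mscale _ _ _ (pushforward mu mphi_pack) _ mD (NngNum c0') _ mf f0).
apply: eq_measure_integral => //= A mA _.
apply: (@lebesgue_measure_unique _ (mscale (NngNum c0') (pushforward mu mphi_pack))) => //=.
move=> _ [[a b]] _ <-; rewrite /mscale/= /pushforward preimage_affine_itv //=.
rewrite !lebesgue_measure_itv/= !lte_fin ltr_pM2r ?invr_gt0 // ltrD2r.
case: ifP => _; last by rewrite mule0.
by rewrite -!EFinB -EFinM; congr EFin; field; rewrite gt_eqF.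
Qed.

Lemma ge0_integral_scale (R : realType) (c : R) (f : R -> \bar R) : 0 < c ->
  measurable_fun (`]0, +oo[ : set R) f -> (forall x : R, (0 < x)%R -> 0 <= f x)%E ->
  (\int[mu]_(x in `]0%R, +oo[) f x = c%:E * \int[mu]_(x in `]0%R, +oo[) f (c * x)%R)%E.
Proof.
move=> c0 mf f0; rewrite (ge0_integral_affine _ c 0) //.
  rewrite preimage_affine_itv //= subrr mul0r.
  by congr (_ * _)%E; apply: eq_integral => x _; rewrite addr0.
by move=> x /=; rewrite in_itv/= andbT; exact: f0.
Qed.

Lemma ge0_integral_shift (R : realType) (f : R -> \bar R) :
  measurable_fun (`]1, +oo[ : set R) f -> (forall x : R, (1 < x)%R -> 0 <= f x)%E ->
  (\int[mu]_(x in `]1%R, +oo[) f x = \int[mu]_(x in `]0%R, +oo[) f (1 + x)%R)%E.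
Proof.
move=> mf f0; rewrite (ge0_integral_affine _ 1 1) //.
  rewrite preimage_affine_itv //= subrr mul0r mul1e.
  by apply: eq_integral => x _; rewrite mul1r addrC.
by move=> x /=; rewrite in_itv/= andbT; exact: f0.
Qed.

(** * Integrals over the positive half-line *)

Local Notation pos R := (`]0, +oo[%classic : set R).

Definition int_pos (R : realType) (f : R -> \bar R) : \bar R :=
  (\int[mu]_(t in `]0%R, +oo[) f t)%E.

Lemma in_pos (R : realType) (x : R) : (x \in pos R) = (0 < x).
Proof. by apply/idP/idP; rewrite inE /= in_itv/= andbT. Qed.

Lemma eq_int_pos (R : realType) (f g : R -> \bar R) :
  (forall t : R, 0 < t -> f t = g t) -> int_pos R f = int_pos R g.
Proof. by move=> fg; apply: eq_integral => t; rewrite in_pos; exact: fg. Qed.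

Lemma int_pos_ge0 (R : realType) (f : R -> \bar R) :
  (forall t : R, (0 < t)%R -> (0 <= f t)%E) -> (0 <= int_pos R f)%E.
Proof.
by move=> f0; apply: integral_ge0 => t /=; rewrite in_itv/= andbT; exact: f0.
Qed.

Lemma int_posZl (R : realType) (k : \bar R) (f : R -> \bar R) :
  measurable_fun setT f -> (forall t : R, (0 < t)%R -> (0 <= f t)%E) ->
  (0 <= k)%E -> int_pos R (fun t => k * f t)%E = (k * int_pos R f)%E.
Proof.
move=> mf f0 k0; apply: ge0_integralZl k0.
- exact: measurable_itv.
- exact: measurable_funTS.
- by move=> t /=; rewrite in_itv/= andbT; exact: f0.
Qed.

Lemma int_pos_scale (R : realType) (c : R) (f : R -> \bar R) : 0 < c ->
  measurable_fun setT f -> (forall t : R, (0 < t)%R -> (0 <= f t)%E) ->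
  int_pos R f = (c%:E * int_pos R (fun t => f (c * t)%R))%E.
Proof.
move=> c0 mf f0; apply: ge0_integral_scale c0 _ f0.
exact: measurable_funTS.
Qed.

(** The sign of [f] is known only on the open quadrant, so [f] is extended by zero outside it and
    Tonelli's theorem is applied on the whole plane. *)
Lemma int_pos_Tonelli (R : realType) (f : R -> R -> R) :
  measurable_fun setT (fun z : R * R => f z.1 z.2) ->
  (forall x y, 0 < x -> 0 < y -> 0 <= f x y) ->
  int_pos R (fun x => int_pos R (fun y => (f x y)%:E)) =
  int_pos R (fun y => int_pos R (fun x => (f x y)%:E)).
Proof.
move=> mf f0.
pose F : R * R -> \bar R := (fun z => (f z.1 z.2)%:E) \_ (pos R `*` pos R).
have FE x y : F (x, y) = if (0 < x) && (0 < y) then (f x y)%:E else 0%E.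
  by rewrite /F patchE in_setX /= !in_pos.
have mF : measurable_fun setT F.
  apply/(measurable_restrictT _ _).1; first exact: measurableX.
  by apply: measurable_funTS; exact/measurable_EFinP.
have F0 z : (0 <= F z)%E.
  case: z => x y; rewrite FE; case: ifPn => // /andP[x0 y0].
  by rewrite lee_fin f0.
have FT := @fubini_tonelli _ _ _ _ _ (@lebesgue_measure R) (@lebesgue_measure R) F mF F0.
rewrite /int_pos [RHS]integral_mkcond [LHS]integral_mkcond.
transitivity (\int[mu]_x \int[mu]_y F (x, y))%E.
  apply: eq_integral => x _; rewrite patchE in_pos.
  case: ifPn => x0; last first.
    by rewrite integral0_eq // => y _; rewrite FE (negbTE x0).
  rewrite integral_mkcond; apply: eq_integral => y _.
  by rewrite FE patchE in_pos x0.
rewrite FT; apply: eq_integral => y _; rewrite patchE in_pos.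
case: ifPn => y0; last first.
  by rewrite integral0_eq // => x _; rewrite FE (negbTE y0) andbF.
rewrite [RHS]integral_mkcond; apply: eq_integral => x _.
by rewrite FE patchE in_pos y0 andbT.
Qed.


Lemma int_posD (R : realType) (f g : R -> \bar R) :
  measurable_fun setT f -> measurable_fun setT g ->
  (forall t : R, (0 < t)%R -> (0 <= f t)%E) ->
  (forall t : R, (0 < t)%R -> (0 <= g t)%E) ->
  int_pos R (fun t => f t + g t)%E = (int_pos R f + int_pos R g)%E.
Proof.
move=> mf mg f0 g0; apply: ge0_integralD.
- exact: measurable_itv.
- by move=> t /=; rewrite in_itv/= andbT; exact: f0.
- exact: measurable_funTS.
- by move=> t /=; rewrite in_itv/= andbT; exact: g0.
- exact: measurable_funTS.
Qed.

Lemma le_int_pos (R : realType) (f g : R -> \bar R) :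
  measurable_fun setT f -> measurable_fun setT g ->
  (forall t : R, (0 < t)%R -> (0 <= f t)%E) ->
  (forall t : R, (0 < t)%R -> (f t <= g t)%E) ->
  (int_pos R f <= int_pos R g)%E.
Proof.
move=> mf mg f0 fg; apply: ge0_le_integral.
- exact: measurable_itv.
- by move=> t /=; rewrite in_itv/= andbT; exact: f0.
- exact: measurable_funTS.
- exact: measurable_funTS.
- by move=> t /=; rewrite in_itv/= andbT; exact: fg.
Qed.

(** * Measurability of explicit integrands *)

Lemma measurable_fun_powR d (T : measurableType d) (R : realType) (D : set T)
  (f : T -> R) (p : R) :
  measurable_fun D f -> measurable_fun D (fun x => f x `^ p).
Proof. by move=> mf; exact: (measurableT_comp (measurable_powR p) mf). Qed.

Lemma measurable_fun_expR d (T : measurableType d) (R : realType) (D : set T)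
  (f : T -> R) :
  measurable_fun D f -> measurable_fun D (fun x => expR (f x)).
Proof. by move=> mf; exact: (measurableT_comp (@measurable_expR R) mf). Qed.

Lemma addrl_measurable (R : realType) (D : set R) (c : R) :
  measurable_fun D ( +%R c).
Proof. by apply: measurable_funD; [exact: measurable_cst|exact: measurable_id]. Qed.

(** Recursion on the syntax of the integrand. The branches for a bare [-%R], [+%R _], [*%R _], [fst]
    or [snd] catch subterms in eta-reduced form. *)
Ltac prove_measurable :=
  cbv beta; lazymatch goal with
  | |- measurable_fun _ (fun x => (@?f x)%:E) => apply/measurable_EFinP; prove_measurable
  | |- measurable_fun _ (fun x => expR (@?f x)) =>
      apply: measurable_fun_expR; prove_measurable
  | |- measurable_fun _ (fun x => (@?f x) `^ _) =>
      apply: measurable_fun_powR; prove_measurable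
  | |- measurable_fun _ (fun x => (@?f x) ^+ _) =>
      apply: measurable_funX; prove_measurable
  | |- measurable_fun _ (fun x => (@?f x) * (@?g x)) =>
      apply: measurable_funM; prove_measurable
  | |- measurable_fun _ (fun x => (@?f x) + (@?g x)) =>
      apply: measurable_funD; prove_measurable
  | |- measurable_fun _ (fun x => - (@?f x)) =>
      apply: measurable_funN; prove_measurable
  | |- measurable_fun _ (fun x => x) => exact: measurable_id
  | |- measurable_fun _ -%R => exact: oppr_measurable
  | |- measurable_fun _ ( +%R _) => exact: addrl_measurable
  | |- measurable_fun _ fst => exact: measurable_fst
  | |- measurable_fun _ snd => exact: measurable_snd
  | |- measurable_fun _ ( *%R _) => exact: mulrl_measurable
  | |- measurable_fun _ (fun x => x.1) => exact: measurable_fst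
  | |- measurable_fun _ (fun x => x.2) => exact: measurable_snd
  | |- measurable_fun _ (fun _ => ?c) => exact: measurable_cst
  end.

Lemma gt0_powRD (R : realType) (x r s : R) : 0 < x ->
  x `^ (r + s) = x `^ r * x `^ s.
Proof. by move=> x0; rewrite powRD // (gt_eqF x0) implybT. Qed.

(** * The Gamma function *)

(* Extended real valued, so that the functional equations below can be proved
   before, and used for, the finiteness of the integral. *)
Definition Gamma_integral (R : realType) (z : R) : \bar R :=
  int_pos R (fun t => (t `^ (z - 1) * expR (- t))%:E).

Lemma Gamma_integral_ge0 (R : realType) (z : R) : (0 <= Gamma_integral R z)%E.
Proof.
by apply: int_pos_ge0 => t _; rewrite lee_fin mulr_ge0 ?powR_ge0 ?expR_ge0.
Qed.

(** After substituting c t for t, the Jacobian [c] joins the factor c^(z-1). *)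
Lemma Gamma_integral_scale (R : realType) (c z : R) : 0 < c ->
  Gamma_integral R z =
  ((c `^ z)%:E * int_pos R (fun t => (t `^ (z - 1) * expR (- (c * t)))%:E))%E.
Proof.
move=> c0; rewrite /Gamma_integral (int_pos_scale _ c _ c0); last 2 first.
- prove_measurable.
- by move=> x x0; rewrite lee_fin mulr_ge0 ?powR_ge0 ?expR_ge0.
rewrite -int_posZl; last 3 first.
- prove_measurable.
- by move=> x x0; rewrite lee_fin mulr_ge0 ?powR_ge0 ?expR_ge0.
- by rewrite lee_fin ltW.
rewrite -int_posZl; last 3 first.
- prove_measurable.
- by move=> x x0; rewrite lee_fin mulr_ge0 ?powR_ge0 ?expR_ge0.
- by rewrite lee_fin powR_ge0.
apply: eq_int_pos => t t0.
rewrite -!EFinM powRM ?(ltW c0) ?(ltW t0) // !mulrA; congr (_ * _ * _)%:E.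
rewrite -{1}(powRr1 (ltW c0)) -gt0_powRD //; congr (_ `^ _); ring.
Qed.

(* Scale the second integral by the variable [x] of the first and exchange. *)
Lemma mul_Gamma_integral (R : realType) (p q : R) :
  (Gamma_integral R p * Gamma_integral R q = Gamma_integral R (p + q) *
   int_pos R (fun v => (v `^ (q - 1) * (1 + v) `^ (- (p + q)))%:E))%E.
Proof.
have v1 (v : R) : 0 < v -> 0 < 1 + v by move=> v0; rewrite addr_gt0.
transitivity (int_pos R (fun x => int_pos R (fun v =>
  (x `^ (p + q - 1) * v `^ (q - 1) * expR (- ((1 + v) * x)))%:E))).
  rewrite muleC -int_posZl; last 3 first.
  - prove_measurable.
  - by move=> x x0; rewrite lee_fin mulr_ge0 ?powR_ge0 ?expR_ge0.
  - exact: Gamma_integral_ge0.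
  apply: eq_int_pos => x x0.
  rewrite muleC (Gamma_integral_scale _ x) // muleA -EFinM -int_posZl; last 3 first.
  - prove_measurable.
  - by move=> v v0; rewrite lee_fin mulr_ge0 ?powR_ge0 ?expR_ge0.
  - by rewrite lee_fin !mulr_ge0 ?powR_ge0 ?expR_ge0.
  apply: eq_int_pos => v v0; rewrite -EFinM; congr EFin.
  rewrite (_ : p + q - 1 = (p - 1) + q); last by ring.
  rewrite (gt0_powRD R x (p - 1) q) // mulrDl mul1r opprD expRD (mulrC v x); ring.
rewrite int_pos_Tonelli; last 2 first.
- prove_measurable.
- by move=> x v _ _; rewrite !mulr_ge0 ?powR_ge0 ?expR_ge0.
rewrite -int_posZl; last 3 first.
- prove_measurable.
- by move=> v v0; rewrite lee_fin mulr_ge0 ?powR_ge0.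
- exact: Gamma_integral_ge0.
apply: eq_int_pos => v v0.
(* For fixed [v] the integral over [x] is Gamma(p+q) (1+v)^(-(p+q)), by scaling with 1 + v. *)
rewrite (Gamma_integral_scale _ (1 + v)) ?v1 // muleC muleA -EFinM.
rewrite -mulrA -gt0_powRD ?v1 //.
rewrite addNr powRr0 mulr1 -int_posZl; last 3 first.
- prove_measurable.
- by move=> x x0; rewrite lee_fin mulr_ge0 ?powR_ge0 ?expR_ge0.
- by rewrite lee_fin powR_ge0.
by apply: eq_int_pos => x x0; rewrite -EFinM; congr EFin; ring.
Qed.

Lemma int_pos_expRN (R : realType) : int_pos R (fun t => (expR (- t))%:E) = 1%E.
Proof.
have cF : continuous (fun x : R => - expR (- x)).
  move=> x; apply: cvgN; apply: (@continuous_comp _ _ _ -%R expR).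
    exact: oppr_continuous.
  exact: continuous_expR.
have dF (x : R) : is_derive x 1 (fun x : R => - expR (- x)) (expR (- x)).
  by apply: is_derive_eq; rewrite mulrN1 opprK.
rewrite /int_pos integral_itv_obnd_cbnd; last first.
  by apply: measurable_funTS; prove_measurable.
rewrite (@ge0_continuous_FTC2y _ _ (fun x => - expR (- x)) 0 0).
- by rewrite oppr0 expR0 -EFinB sub0r opprK.
- by move=> x _; exact: expR_ge0.
- apply: continuous_subspaceT => x; apply: (@continuous_comp _ _ _ -%R expR).
    exact: oppr_continuous.
  exact: continuous_expR.
- by rewrite -[X in _ --> X]oppr0; apply: cvgN; exact: cvgr_expR.
- by move=> x _; exact: ex_derive.
- exact/cvg_at_right_filter/cF.
- by move=> x _; rewrite derive1E derive_val.
Qed.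

Lemma powRN_cvg0 (R : realType) (p : R) : 0 < p -> x `^ (- p) @[x --> +oo] --> 0.
Proof.
move=> p0; apply/cvgrPdist_lt => e e0; near=> x.
have x0 : 0 < x by near: x; exact: nbhs_pinfty_gt.
rewrite sub0r normrN ger0_norm ?powR_ge0 // /powR gt_eqF // -[ltRHS](@lnK _ e) ?posrE //.
rewrite ltr_expR mulNr ltrNl -ltr_pdivrMl // -(@expRK _ (_ * _)) ltr_ln ?posrE ?expR_gt0 //.
Unshelve. all: by end_near. Qed.

(** With u = 1 + v, the antiderivative is -u^(-p)/p. This case q = 1 of the Beta integral is what
    turns [mul_Gamma_integral] into the functional equation of Gamma. *)
Lemma int_pos_powRND (R : realType) (p : R) : 0 < p ->
  int_pos R (fun v => ((1 + v) `^ (- (p + 1)))%:E) = (p^-1)%:E.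
Proof.
move=> p0; rewrite /int_pos.
rewrite -(@ge0_integral_shift _ (fun u => (u `^ (- (p + 1)))%:E)); last 2 first.
- by apply: measurable_funTS; prove_measurable.
- by move=> x _; rewrite lee_fin powR_ge0.
rewrite integral_itv_obnd_cbnd; last first.
  by apply: measurable_funTS; prove_measurable.
have dpow (x : R) : 0 < x ->
    is_derive x 1 (fun x : R => - p^-1 * x `^ (- p)) (x `^ (- (p + 1))).
  move=> x0.
  have xin : x \in `]0, +oo[ by rewrite in_itv/= x0.
  have := @derivable_powR R 1 (- p) x xin.
  move=> /derivableP dx.
  have := @is_deriveZ _ _ _ _ (- p^-1) _ _ _ dx.
  have := @powR_derive1 R (- p) x xin. rewrite derive1E => ->.
  move=> /@is_derive_eq; apply.
  by rewrite /GRing.scale /= mulrA mulrNN mulVf ?gt_eqF // mul1r opprD.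
have cpow (q x : R) : 0 < x -> {for x, continuous (fun x : R => x `^ q)}.
  move=> x0; apply: differentiable_continuous; apply/derivable1_diffP.
  by apply: derivable_powR; rewrite in_itv/= x0.
rewrite (@ge0_continuous_FTC2y _ _ (fun x => - p^-1 * x `^ (- p)) 1 0).
- by rewrite powR1 mulr1 -EFinB sub0r opprK.
- by move=> x _; exact: powR_ge0.
- apply: continuous_in_subspaceT => x; rewrite inE /= in_itv/= andbT => x1.
  by apply: cpow; exact: lt_le_trans x1.
- by rewrite -[X in _ --> X](mulr0 (- p^-1)); apply: cvgMr; exact: powRN_cvg0.
- by move=> x x1; have := dpow x (lt_trans ltr01 x1) => ?; exact: ex_derive.
- by apply: cvg_at_right_filter; apply: cvgMr; exact: cpow.
- move=> x; rewrite in_itv/= andbT => x1; rewrite derive1E.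
  by have := dpow x (lt_trans ltr01 x1) => ?; rewrite derive_val.
Qed.

Lemma Gamma_integral1 (R : realType) : Gamma_integral R 1 = 1%E.
Proof.
rewrite -[RHS](int_pos_expRN R); apply: eq_int_pos => t t0.
by rewrite subrr powRr0 mul1r.
Qed.

(** Take q = 1 in [mul_Gamma_integral]: Gamma(1) = 1 and the remaining integral is 1/p. The identity
    holds in the extended reals, so it can serve to prove finiteness. *)
Lemma Gamma_integralD1 (R : realType) (p : R) : 0 < p ->
  Gamma_integral R (p + 1) = (p%:E * Gamma_integral R p)%E.
Proof.
move=> p0; have := mul_Gamma_integral R p 1.
rewrite Gamma_integral1 mule1.
rewrite (_ : int_pos R _ = (p^-1)%:E); last first.
  rewrite -(int_pos_powRND _ _ p0); apply: eq_int_pos => v v0.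
  by rewrite subrr powRr0 mul1r.
move=> ->; rewrite muleC -muleA -EFinM mulVf ?gt_eqF // mule1 //.
Qed.

(** The functional equation gives finiteness at positive integers. For 0 <= p <= n, the bound t^p <=
    1 + t^n then gives it at p + 1, and the functional equation brings it back from z + 1 to z. *)
Lemma Gamma_integral_lt_pinfty (R : realType) (z : R) : 0 < z ->
  (Gamma_integral R z < +oo)%E.
Proof.
move=> z0.
have nat1 (n : nat) : (Gamma_integral R n.+1%:R < +oo)%E.
  elim: n => [|n ih]; first by rewrite Gamma_integral1 ltry.
  by rewrite -natr1 Gamma_integralD1 // lte_mul_pinfty.
have ge1 (p : R) : 0 <= p -> (Gamma_integral R (p + 1) < +oo)%E.
  move=> p0; have [n pn] : exists n : nat, p <= n%:R.
    by exists (Num.bound p); rewrite ltW // archi_boundP.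
  apply: (@le_lt_trans _ _ (Gamma_integral R 1 + Gamma_integral R n.+1%:R)%E); last first.
    by rewrite lte_add_pinfty // Gamma_integral1 ltry.
  have m (w : R) : measurable_fun setT (fun t => (t `^ (w - 1) * expR (- t))%:E).
    by prove_measurable.
  have ge0 (w t : R) : 0 < t -> (0 <= (t `^ (w - 1) * expR (- t))%:E)%E.
    by move=> _; rewrite lee_fin mulr_ge0 ?powR_ge0 ?expR_ge0.
  rewrite -int_posD; [|exact: m|exact: m|exact: ge0|exact: ge0].
  apply: le_int_pos => [|||t t0]; [exact: m| |exact: ge0|].
    by apply: emeasurable_funD; exact: m.
  rewrite -EFinD lee_fin -mulrDl ler_wpM2r ?expR_ge0 // addrK subrr powRr0 -natr1 addrK.
  have [t1|/ltW t1] := leP 1 t.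
    by rewrite (le_trans (ler_powR t1 pn)) // lerDr.
  have := ge0_ler_powR p0 (ltW t0 : t \is Num.nneg) (ler01 : 1 \is Num.nneg) t1.
  by rewrite powR1 => /le_trans; apply; rewrite lerDl powR_ge0.
suff : (Gamma_integral R (z + 1) < +oo)%E.
  rewrite Gamma_integralD1 //; have := Gamma_integral_ge0 R z.
  case: (Gamma_integral R z) => //= [r|]; first by rewrite !ltry.
  by rewrite gt0_muley ?lte_fin.
exact/ge1/ltW.
Qed.

(** By the functional equation it suffices to treat z + 1, where the integrand t^z e^(-t) is at
    least e^(-2) on [1, 2]. *)
Lemma Gamma_integral_gt0 (R : realType) (z : R) : 0 < z -> (0 < Gamma_integral R z)%E.
Proof.
move=> z0.
suff : (0 < Gamma_integral R (z + 1))%E.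
  rewrite Gamma_integralD1 //; have := Gamma_integral_ge0 R z.
  by rewrite le_eqVlt => /predU1P[<-|//]; rewrite mule0 ltxx.
have mG (D : set R) : measurable_fun D (fun t => (t `^ (z + 1 - 1) * expR (- t))%:E).
  by apply: measurable_funTS; prove_measurable.
have D12 (t : R) : `[1, 2]%classic t ->
    0 < t /\ (expR (- 2) <= t `^ (z + 1 - 1) * expR (- t)).
  rewrite /= in_itv/= => /andP[t1 t2]; split; first exact: lt_le_trans t1.
  rewrite -[leLHS]mul1r ler_pM ?expR_ge0 ?ler_expR ?lerN2 // addrK.
  by rewrite (le_trans _ (ler_powR t1 (ltW z0))) // powRr0.
apply: (@lt_le_trans _ _ (\int[mu]_(t in `[1%R, 2%R]) (expR (- 2))%:E)%E).
  rewrite integral_cst; last exact: measurable_itv.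
  rewrite /= lebesgue_measure_itv /= lte_fin ltr1n -EFinB -EFinM lte_fin.
  by rewrite mulr_gt0 ?expR_gt0 // subr_gt0 ltr1n.
apply: (@le_trans _ _ (\int[mu]_(t in `[1%R, 2%R]) (t `^ (z + 1 - 1) * expR (- t))%:E)%E).
  apply: ge0_le_integral => [|t _|||t /D12[_]]; [exact: measurable_itv| | |exact: mG|].
  - by rewrite lee_fin expR_ge0.
  - exact: measurable_cst.
  - by rewrite lee_fin.
apply: ge0_subset_integral; [exact: measurable_itv|exact: measurable_itv|exact: mG| |].
- by move=> t _; rewrite lee_fin mulr_ge0 ?powR_ge0 ?expR_ge0.
- by move=> t /D12[t0 _] /=; rewrite in_itv/= t0.
Qed.

(** [Gamma] is the [fine] part of the integral, which would send an infinite value to 0; finiteness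
    makes it faithful. *)
Lemma GammaE (R : realType) (z : R) : 0 < z -> (Gamma z)%:E = Gamma_integral R z.
Proof.
move=> z0; rewrite /Gamma /Rintegral -/(int_pos R _) fineK //.
rewrite fin_numElt (lt_le_trans _ (Gamma_integral_ge0 _ _)) ?ltNyr //.
exact: Gamma_integral_lt_pinfty.
Qed.

Lemma Gamma_gt0 (R : realType) (z : R) : 0 < z -> 0 < Gamma z.
Proof. by move=> z0; rewrite -lte_fin GammaE // Gamma_integral_gt0. Qed.

Lemma GammaD1 (R : realType) (z : R) : 0 < z -> Gamma (z + 1) = z * Gamma z.
Proof.
move=> z0; apply: EFin_inj; rewrite EFinM !GammaE ?Gamma_integralD1 //.
by rewrite addr_gt0.
Qed.

Lemma GammaDn (R : realType) (z : R) (n : nat) : 0 < z ->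
  Gamma (z + n%:R) = rising_factorial z n * Gamma z.
Proof.
move=> z0; elim: n => [|n ih].
  by rewrite addr0 /rising_factorial big_ord0 mul1r.
have zn : 0 < z + n%:R by rewrite ltr_wpDr.
rewrite -natr1 addrA (GammaD1 _ _ zn) ih /rising_factorial big_ord_recr /=; ring.
Qed.

(** * Euler's integral for the Gauss series *)

Lemma rising_factorial_gt0 (R : realType) (z : R) (n : nat) :
  0 < z -> 0 < rising_factorial z n.
Proof. by move=> z0; apply: prodr_gt0 => i _; rewrite ltr_wpDr. Qed.

(** Termwise integration produces an extended real sum, whereas the Gauss series is defined as a
    limit of real partial sums. *)
Lemma limn_series_nneseries (R : realType) (f : R^nat) (l : R) :
  (forall n, 0 <= f n) -> (\sum_(0 <= n <oo) (f n)%:E = l%:E)%E ->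
  limn (series f) = l.
Proof.
move=> f0 fl.
have : (\sum_(0 <= k < n) (f k)%:E)%E @[n --> \oo] --> l%:E.
  by rewrite -fl; apply: is_cvg_nneseries => n _ _; rewrite lee_fin.
move=> /fine_cvg; rewrite /= => fl'; apply/cvg_lim => //.
apply: cvg_trans fl'; apply: near_eq_cvg; near=> n.
by rewrite /= sumEFin.
Unshelve. all: by end_near. Qed.

Lemma expR_nneseries (R : realType) (x : R) :
  ((expR x)%:E = \sum_(0 <= n <oo) (x ^+ n / n`!%:R)%:E)%E.
Proof.
rewrite /expR -EFin_lim; last exact: is_cvg_series_exp_coeff.
by congr (limn _); apply/funext => n /=; rewrite sumEFin.
Qed.

Lemma int_pos_nneseries (R : realType) (f : nat -> R -> \bar R) :
  (forall n, measurable_fun setT (f n)) ->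
  (forall n (t : R), (0 < t)%R -> (0 <= f n t)%E) ->
  int_pos R (fun t => \sum_(0 <= n <oo) f n t)%E =
  (\sum_(0 <= n <oo) int_pos R (f n))%E.
Proof.
move=> mf f0; apply: integral_nneseries.
- exact: measurable_itv.
- by move=> n; apply: measurable_funTS; exact: mf.
- by move=> n t /=; rewrite in_itv/= andbT; exact: f0.
Qed.

(* Expand [expR (t * y)] in Gamma(g) (1-y)^(-g) = int t^(g-1) e^(-t) e^(ty) dt. *)
Lemma negative_binomial_series (R : realType) (g y : R) : 0 < g -> 0 <= y < 1 ->
  (((1 - y) `^ (- g))%:E =
   \sum_(0 <= n <oo) (rising_factorial g n * (y ^+ n / n`!%:R))%:E)%E.
Proof.
move=> g0 /andP[y0 y1]; have y1' : 0 < 1 - y by rewrite subr_gt0.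
have t0 n : 0 <= y ^+ n / n`!%:R by rewrite divr_ge0 ?exprn_ge0.
(* Scaling Euler's integral by 1 - y turns the left side into the integral of t^(g-1) e^(-(1-y)t);
   the factor Gamma(g) is divided out at the end. *)
have : ((Gamma g)%:E * ((1 - y) `^ (- g))%:E =
    \sum_(0 <= n <oo) (Gamma g)%:E * (rising_factorial g n * (y ^+ n / n`!%:R))%:E)%E.
  rewrite [in LHS]GammaE // [in LHS](Gamma_integral_scale _ (1 - y)) //.
  rewrite muleC muleA -EFinM -gt0_powRD // addNr powRr0 mul1e.
  transitivity (int_pos R (fun t => \sum_(0 <= n <oo)
      ((y ^+ n / n`!%:R)%:E * (t `^ (g + n%:R - 1) * expR (- t))%:E)))%E.
    apply: eq_int_pos => t t0'.
    rewrite (_ : - ((1 - y) * t) = - t + y * t); last by ring.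
    rewrite expRD mulrA EFinM expR_nneseries -nneseriesZl; last first.
      by move=> n _; rewrite lee_fin divr_ge0 ?exprn_ge0 ?mulr_ge0 // ltW.
    apply: eq_eseriesr => n _; rewrite -!EFinM; congr EFin.
    rewrite exprMn addrAC (gt0_powRD R t (g - 1) n%:R) // powR_mulrn ?(ltW t0') //; ring.
  rewrite int_pos_nneseries; last 2 first.
  - by move=> n; apply: measurable_funeM; prove_measurable.
  - by move=> n t _; rewrite mule_ge0 // lee_fin // mulr_ge0 ?powR_ge0 ?expR_ge0.
  apply: eq_eseriesr => n _; rewrite int_posZl; last 3 first.
  - by prove_measurable.
  - by move=> t _; rewrite lee_fin mulr_ge0 ?powR_ge0 ?expR_ge0.
  - by rewrite lee_fin.
  (* The n-th term integrates to Gamma(g+n), which is the rising factorial times Gamma(g). *)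
  have gn : 0 < g + n%:R by rewrite ltr_wpDr.
  rewrite -/(Gamma_integral R (g + n%:R)) -GammaE // GammaDn // -!EFinM; congr EFin; ring.
rewrite nneseriesZl; last first.
  by move=> n _; rewrite lee_fin mulr_ge0 // ltW // rising_factorial_gt0.
move=> /(congr1 (fun z => (Gamma g)^-1%:E * z)%E); rewrite !muleA -!EFinM.
by rewrite mulVf ?gt_eqF ?Gamma_gt0 // mul1r mul1e.
Qed.

(** Divide [mul_Gamma_integral] by Gamma(p+q), now known to be finite and positive. *)
Lemma Beta_integral (R : realType) (p q : R) : 0 < p -> 0 < q ->
  int_pos R (fun v => (v `^ (q - 1) * (1 + v) `^ (- (p + q)))%:E) =
  (Gamma p * Gamma q / Gamma (p + q))%:E.
Proof.
move=> p0 q0; have pq : 0 < p + q by rewrite addr_gt0.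
have := mul_Gamma_integral R p q; rewrite -!GammaE //.
move=> /(congr1 (fun z => (Gamma (p + q))^-1%:E * z)%E).
rewrite -!EFinM muleA -EFinM mulVf ?gt_eqF ?Gamma_gt0 // mul1e => <-.
by rewrite mulrC.
Qed.

(* Expanding in powers of [x v / (1 + v)] and integrating termwise. *)
Lemma hypergeometric_2F1_integral (R : realType) (a b c x : R) :
  0 < a -> a < c -> 0 < b -> 0 <= x <= 1 -> a + b < c ->
  (int_pos R (fun v => (v `^ (a - 1) * (1 + v) `^ (b - c)
     * (1 + (1 - x) * v) `^ (- b))%:E) =
   (Gamma a * Gamma (c - a) / Gamma c * hypergeometric_2F1 a b c x)%:E)%E.
Proof.
move=> a0 ac b0 /andP[x0 x1] abc.
have c0 : 0 < c := lt_trans a0 ac.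
have ca0 : 0 < c - a by rewrite subr_gt0.
pose k := Gamma a * Gamma (c - a) / Gamma c.
have k0 : 0 < k by rewrite divr_gt0 ?mulr_gt0 ?Gamma_gt0.
pose f n := rising_factorial a n * rising_factorial b n / rising_factorial c n
      * (x ^+ n / n`!%:R).
have f0 n : 0 <= f n.
  by rewrite /f mulr_ge0 ?divr_ge0 ?mulr_ge0 ?exprn_ge0 ?(ltW (rising_factorial_gt0 _ _ _ _)).
have b0' n : 0 <= rising_factorial b n * (x ^+ n / n`!%:R).
  by rewrite mulr_ge0 ?divr_ge0 ?exprn_ge0 ?(ltW (rising_factorial_gt0 _ _ _ _)).
have E : int_pos R (fun v => (v `^ (a - 1) * (1 + v) `^ (b - c)
     * (1 + (1 - x) * v) `^ (- b))%:E) = (k%:E * \sum_(0 <= n <oo) (f n)%:E)%E.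
  transitivity (int_pos R (fun v => \sum_(0 <= n <oo)
     ((rising_factorial b n * (x ^+ n / n`!%:R))%:E *
     (v `^ (a + n%:R - 1) * (1 + v) `^ (- (c - a + (a + n%:R))))%:E)))%E.
    apply: eq_int_pos => v v0; have v1 : 0 < 1 + v by rewrite addr_gt0.
    (* Since 1 + (1-x) v = (1+v) (1 - x v/(1+v)), the power (1+v)^b cancels and leaves a negative
       binomial in x v/(1+v), which lies in [0, 1) because x <= 1. *)
    have -> : v `^ (a - 1) * (1 + v) `^ (b - c) * (1 + (1 - x) * v) `^ (- b) =
       v `^ (a - 1) * (1 + v) `^ (- c) * (1 - x * v / (1 + v)) `^ (- b).
      have -> : 1 - x * v / (1 + v) = (1 + (1 - x) * v) * (1 + v)^-1.
        by field; rewrite gt_eqF.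
      rewrite powRM ?invr_ge0 ?(ltW v1) ?addr_ge0 ?mulr_ge0 ?subr_ge0 ?(ltW v0) //.
      rewrite -(powR_inv1 (ltW v1)) -powRrM mulN1r opprK (gt0_powRD R (1 + v) b) //; ring.
    rewrite EFinM negative_binomial_series //; last first.
      rewrite divr_ge0 ?mulr_ge0 ?(ltW v0) ?(ltW v1) //= ltr_pdivrMr // mul1r.
      by apply: le_lt_trans (_ : v < _); [rewrite ler_piMl // ltW|rewrite ltrDr].
    rewrite -nneseriesZl; last first.
      move=> n _; rewrite lee_fin mulr_ge0 ?(ltW (rising_factorial_gt0 _ _ _ _)) //.
      by rewrite divr_ge0 // exprn_ge0 // divr_ge0 ?mulr_ge0 ?(ltW v0) ?(ltW v1).
    apply: eq_eseriesr => n _; rewrite -!EFinM; congr EFin.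
    rewrite (_ : - (c - a + (a + n%:R)) = - c + - n%:R); last by ring.
    rewrite (gt0_powRD R (1 + v)) // addrAC (gt0_powRD R v (a - 1)) //.
    rewrite powR_mulrn ?(ltW v0) // powR_invn ?(ltW v1) // !exprMn exprVn; ring.
  rewrite int_pos_nneseries; last 2 first.
  - by move=> n; apply: measurable_funeM; prove_measurable.
  - by move=> n v _; rewrite mule_ge0 // lee_fin // mulr_ge0 ?powR_ge0.
  rewrite -nneseriesZl; last by move=> n _; rewrite lee_fin.
  apply: eq_eseriesr => n _; rewrite int_posZl; last 3 first.
  - by prove_measurable.
  - by move=> v _; rewrite lee_fin mulr_ge0 ?powR_ge0.
  - by rewrite lee_fin.
  have an : 0 < a + n%:R by rewrite ltr_wpDr.
  (* The n-th integral is a Beta value with parameters c - a and a + n; the shifts by n in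
     Gamma(a+n) / Gamma(c+n) come out as rising factorials. *)
  rewrite (Beta_integral _ _ _ ca0 an) -!EFinM; congr EFin.
  have Gcn := lt0r_neq0 (Gamma_gt0 _ _ c0).
  have rcn := lt0r_neq0 (rising_factorial_gt0 _ _ n c0).
  rewrite addrA subrK (GammaDn _ _ _ a0) (GammaDn _ _ _ c0) /f /k.
  move: (Gamma a) (Gamma (c - a)) (Gamma c) (rising_factorial c n) Gcn rcn.
  move: (rising_factorial a n) (rising_factorial b n) (x ^+ n / n`!%:R) => *.
  by field; apply/andP.
(* The sum is finite because the integral is: as x <= 1, the factor (1 + (1-x) v)^(-b) is at most 1,
   and what remains is a Beta integral, convergent by a + b < c. The endpoint x = 1 is covered. *)
have fin : (\sum_(0 <= n <oo) (f n)%:E)%E \is a fin_num.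
  rewrite ge0_fin_numE; last by apply: nneseries_ge0 => n _ _; rewrite lee_fin.
  rewrite -(@lte_pmul2l _ k%:E) // -?E ?lte_fin //.
  apply: (@le_lt_trans _ _ (int_pos R
    (fun v => (v `^ (a - 1) * (1 + v) `^ (- (c - b - a + a)))%:E))).
    apply: le_int_pos => [||v v0|v v0].
    - by prove_measurable.
    - by prove_measurable.
    - by rewrite lee_fin !mulr_ge0 ?powR_ge0.
    - rewrite lee_fin subrK opprB ler_piMr ?mulr_ge0 ?powR_ge0 //.
      have w1 : 1 <= 1 + (1 - x) * v.
        by rewrite lerDl mulr_ge0 ?subr_ge0 // ltW.
      have := ler_powR w1 (ltW b0); rewrite powRr0 => wb.
      by rewrite powRN invf_le1 // (lt_le_trans ltr01).
  have cba : 0 < c - b - a by lra.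
  by rewrite (Beta_integral _ _ _ cba a0) gt0_muley ?lte_fin // ltry.
rewrite E [RHS]EFinM; congr (_ * _)%E; rewrite /hypergeometric_2F1 -/f.
by rewrite (@limn_series_nneseries _ f (fine (\sum_(0 <= n <oo) (f n)%:E)%E)) ?fineK.
Qed.

(** * Uniform estimates *)

(** Use 1 - e^(-(q-p)) <= q - p. The factor e^(-p) is kept, since it later absorbs polynomial growth
    of q - p and makes the bounds uniform in y. *)
Lemma expRN_lipschitz (R : realType) (p q : R) : p <= q ->
  `|expR (- p) - expR (- q)| <= (q - p) * expR (- p).
Proof.
move=> pq; rewrite ger0_norm ?subr_ge0 ?ler_expR ?lerN2 //.
have -> : - q = - p + (- (q - p)) by ring.
rewrite expRD; have := expR_ge1Dx (- (q - p)); have := expR_gt0 (- p).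
by move: (expR _) (expR _) => E F; nra.
Qed.

Lemma mulr_expRN_le1 (R : realType) (z : R) : z * expR (- z) <= 1.
Proof.
rewrite expRN ler_pdivrMr ?expR_gt0 // mul1r.
by rewrite (le_trans _ (expR_ge1Dx _)) // lerDr.
Qed.

Lemma sqr_mulr_expRN_le2 (R : realType) (z : R) : 0 <= z ->
  z ^+ 2 * expR (- z) <= 2.
Proof.
move=> z0; rewrite expRN ler_pdivrMr ?expR_gt0 //.
by have := expR_ge1Dxn 1 z0; rewrite (_ : (2`!%:R : R) = 2) //; lra.
Qed.

(** For l <= n, [expRN_lipschitz] gives (n-l) y e^(-ly), and y e^(-ly) <= 1/l <= 1/m. *)
Lemma dist_expRN_scale (R : realType) (m l n y : R) :
  0 < m -> m <= l -> m <= n -> 0 <= y ->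
  `|expR (- (l * y)) - expR (- (n * y))| <= `|l - n| / m.
Proof.
move=> m0; wlog ln : l n / l <= n => [hw ml mn y0|ml mn y0].
  have [ln|/ltW nl] := leP l n; first exact: hw.
  by rewrite distrC (distrC l); exact: hw.
rewrite (le_trans (expRN_lipschitz _ _ _ _)) ?ler_wpM2r //.
rewrite (distrC l) ger0_norm ?subr_ge0 // -mulrBl -mulrA ler_wpM2l ?subr_ge0 //.
rewrite -[leRHS]mul1r ler_pdivlMr //; apply: le_trans (mulr_expRN_le1 R (l * y)).
by rewrite mulrAC (mulrC l) ler_wpM2r ?expR_ge0 // ler_wpM2l.
Qed.

Lemma powRE_gt0 (R : realType) (x p : R) : 0 < x -> x `^ p = expR (- (- (p * ln x))).
Proof. by move=> x0; rewrite opprK /powR gt_eqF. Qed.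

(** Apply ln(1+t) <= t at t = 1/x - 1. *)
Lemma ln_ge_1BV (R : realType) (x : R) : 0 < x -> 1 - x^-1 <= ln x.
Proof.
move=> x0; have xV : 0 < x^-1 by rewrite invr_gt0.
have : ln (1 + (x^-1 - 1)) <= x^-1 - 1 by apply: le_ln1Dx; lra.
by rewrite addrC subrK lnV ?posrE //; lra.
Qed.

(** For y <= 1/2, -y - 2y^2 <= ln(1-y) <= -y, so the exponents differ by at most 2ny^2, and (ny)^2
    e^(-ny) <= 2 gives the bound 4/n. For y > 1/2 both terms are at most e^(-n/2) <= 2/n. *)
Lemma dist_powR_1B_expRN (R : realType) (n y : R) : 0 < n -> 0 <= y <= 1 ->
  `|(1 - y) `^ n - expR (- (n * y))| <= 8 / n.
Proof.
move=> n0 /andP[y0 y1].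
have [y2|y2] := leP y 2^-1.
  have x0 : 0 < 1 - y by lra.
  have l1 : ln (1 - y) <= - y by apply: le_ln1Dx; lra.
  have l2 : - y - 2 * y ^+ 2 <= ln (1 - y).
    apply: le_trans (ln_ge_1BV R _ x0).
    rewrite -subr_ge0 (_ : 1 - (1 - y)^-1 - (- y - 2 * y ^+ 2) =
      (y ^+ 2 * (1 - 2 * y)) / (1 - y)); last by field; rewrite gt_eqF.
    by rewrite divr_ge0 ?(ltW x0) // mulr_ge0 ?sqr_ge0 //; lra.
  rewrite powRE_gt0 // distrC (le_trans (expRN_lipschitz _ _ _ _)) //; first nra.
  have := sqr_mulr_expRN_le2 R (n * y) (mulr_ge0 (ltW n0) y0).
  have := expR_gt0 (- (n * y)); rewrite ler_pdivlMr // exprMn.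
  set E := expR _; set L := ln _ in l1 l2 *; clearbody E L => E0 h.
  have : (- (n * L) - n * y) * E * n <= (2 * n * y ^+ 2) * E * n.
    by rewrite ler_pM2r // ler_pM2r //; nra.
  nra.
have z : expR (- (n / 2)) <= 2 / n.
  rewrite ler_pdivlMr //; have := mulr_expRN_le1 R (n / 2); lra.
have e0 := expR_gt0 (- (n * y)).
have p0 : 0 <= (1 - y) `^ n by exact: powR_ge0.
have e2 : expR (- (n * y)) <= expR (- (n / 2)) by rewrite ler_expR; nra.
have p2 : (1 - y) `^ n <= expR (- (n / 2)).
  (* The exponential form of the power requires a positive base, so y = 1 is treated apart. *)
  have [->|yn1] := eqVneq y 1; first by rewrite subrr powR0 ?gt_eqF // expR_ge0.
  have x0 : 0 < 1 - y by rewrite subr_gt0 lt_neqAle yn1.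
  have l1 : ln (1 - y) <= - y by apply: le_ln1Dx; lra.
  by rewrite powRE_gt0 // ler_expR; nra.
have n2 : 0 < n^-1 by rewrite invr_gt0.
by rewrite ler_norml; apply/andP; split; lra.
Qed.

(** Here the power is the larger term. For y <= 1, ln(1+y) >= y/2 bounds it by e^(-ny/2), and
    ln(1+y) >= y - y^2 bounds the difference of exponents by ny^2; then (ny/2)^2 e^(-ny/2) <= 2
    yields the constant 8. For y >= 1, ln(1+y) >= 1/2, so both terms are at most e^(-n/2) <= 2/n. *)
Lemma dist_powR_1DV_expRN (R : realType) (n y : R) : 0 < n -> 0 <= y ->
  `|(1 + y) `^ (- n) - expR (- (n * y))| <= 8 / n.
Proof.
move=> n0 y0; have x0 : 0 < 1 + y by lra.
have l1 : ln (1 + y) <= y by apply: le_ln1Dx; lra.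
have l2 := ln_ge_1BV R _ x0.
rewrite powRE_gt0 // mulNr opprK.
have z : expR (- (n / 2)) <= 2 / n.
  rewrite ler_pdivlMr //; have := mulr_expRN_le1 R (n / 2); lra.
have [y1|/ltW y1] := leP y 1.
  have l3 : y / 2 <= ln (1 + y).
    apply: le_trans l2.
    rewrite -subr_ge0 (_ : _ - _ = (y * (1 - y)) / (2 * (1 + y))); last first.
      by field; rewrite gt_eqF.
    by rewrite divr_ge0 ?mulr_ge0 ?(ltW x0) //; lra.
  have l4 : y - y ^+ 2 <= ln (1 + y).
    apply: le_trans l2.
    rewrite -subr_ge0 (_ : _ - _ = (y ^+ 3) / (1 + y)); last by field; rewrite gt_eqF.
    by rewrite divr_ge0 ?exprn_ge0 ?(ltW x0).
  rewrite (le_trans (expRN_lipschitz _ _ _ _)) //; first nra.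
  have := sqr_mulr_expRN_le2 R (n * (y / 2)) (mulr_ge0 (ltW n0) (divr_ge0 y0 (ler0n _ 2))).
  have : expR (- (n * ln (1 + y))) <= expR (- (n * (y / 2))).
    by rewrite ler_expR lerN2 ler_pM2l.
  have := expR_gt0 (- (n * ln (1 + y))); rewrite ler_pdivlMr // exprMn.
  set E := expR (- (n * ln (1 + y))); set F := expR _; set L := ln _ in l1 l3 l4 *.
  clearbody E F L => E0 EF h.
  have : (n * y - n * L) * E * n <= (n * y ^+ 2) * F * n.
    have a1 : 0 <= n * y - n * L by rewrite -mulrBr mulr_ge0 ?(ltW n0) // subr_ge0.
    have a2 : n * y - n * L <= n * y ^+ 2 by rewrite -mulrBr ler_pM2l //; lra.
    by rewrite ler_pM2r // ler_pM // ltW.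
  nra.
have l3 : 2^-1 <= ln (1 + y).
  apply: le_trans l2; rewrite -subr_ge0.
  rewrite (_ : _ - _ = (y - 1) / (2 * (1 + y))); last by field; rewrite gt_eqF.
  by rewrite divr_ge0 ?mulr_ge0 ?(ltW x0) //; lra.
have e1 := expR_gt0 (- (n * ln (1 + y))).
have e0 := expR_gt0 (- (n * y)).
have e2 : expR (- (n * ln (1 + y))) <= expR (- (n / 2)) by rewrite ler_expR lerN2 ler_pM2l.
have e3 : expR (- (n * y)) <= expR (- (n / 2)) by rewrite ler_expR; nra.
have n2 : 0 < n^-1 by rewrite invr_gt0.
by rewrite ler_norml; apply/andP; split; lra.
Qed.

(** The Gaussian factors as e^(-l rho) e^(-l rho v), and each factor is compared with one power:
    first to the exponential with the exponent [n] or [k] of that power, at cost 8/m, then to the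
    one with [l]. The bound depends on neither [rho] nor [v]. *)
Lemma dist_mixture_factor (R : realType) (m l n k rho v : R) :
  0 < m -> m <= l -> m <= n -> m <= k -> 0 <= rho -> 0 <= v ->
  let x := Num.max (1 - rho) 0 in
  `|x `^ n * (1 + (1 - x) * v) `^ (- k) - expR (- ((1 + v) * (l * rho)))|
    <= (16 + `|l - n| + `|l - k|) / m.
Proof.
move=> m0 ml mn mk rho0 v0 /=; set x := Num.max _ _.
have l0 : 0 < l := lt_le_trans m0 ml.
have n0 : 0 < n := lt_le_trans m0 mn.
have k0 : 0 < k := lt_le_trans m0 mk.
have -> : expR (- ((1 + v) * (l * rho))) = expR (- (l * rho)) * expR (- (l * (rho * v))).
  by rewrite -expRD; congr expR; ring.
have m_inv : 0 < m^-1 by rewrite invr_gt0.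
(* Outside the ball x = 0, and n > 0 makes its power vanish; the Gaussian is at most e^(-l) <= 1/l
   <= 1/m. *)
have [rho1|rho1] := leP rho 1; last first.
  have -> : x = 0 by apply/max_idPr; lra.
  rewrite powR0 ?gt_eqF // mul0r sub0r normrN ger0_norm ?mulr_ge0 ?expR_ge0 //.
  apply: (@le_trans _ _ (1 / m)); last first.
    by rewrite ler_pM2r //; have := normr_ge0 (l - n); have := normr_ge0 (l - k); lra.
  apply: (@le_trans _ _ (expR (- l) * 1)).
    rewrite ler_pM ?expR_ge0 // ?ler_expR; first nra.
    by rewrite expR_le1 oppr_le0 !mulr_ge0 // ltW.
  rewrite mulr1 ler_pdivlMr //; apply: le_trans (mulr_expRN_le1 R l).
  by rewrite mulrC ler_pM2r ?expR_gt0.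
have -> : x = 1 - rho by apply/max_idPl; lra.
rewrite (_ : 1 - (1 - rho) = rho); last by ring.
have rv0 : 0 <= rho * v by rewrite mulr_ge0.
have b8 (t : R) : m <= t -> 8 / t <= 8 / m.
  by move=> mt; rewrite ler_pM2l // lef_pV2 ?posrE // (lt_le_trans m0 mt).
have h1 := le_trans (dist_powR_1B_expRN R n rho n0 _) (b8 n mn).
have h2 := le_trans (dist_powR_1DV_expRN R k (rho * v) k0 rv0) (b8 k mk).
have h3 := dist_expRN_scale R m l n rho m0 ml mn rho0.
have h4 := dist_expRN_scale R m l k (rho * v) m0 ml mk rv0.
have {}h1 := h1 (introT andP (conj rho0 rho1)).
have E0 : 0 <= expR (- (l * rho)) <= 1.
  by rewrite expR_ge0 expR_le1 oppr_le0 mulr_ge0 // ltW.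
have Q0 : 0 <= (1 + rho * v) `^ (- k) <= 1.
  rewrite powR_ge0 /= powRN invf_le1 ?powR_gt0 ?ltr_wpDr //.
  by have := ler_powR (_ : 1 <= 1 + rho * v) (ltW k0); rewrite powRr0 lerDl; exact.
set P := (1 - rho) `^ n in h1 *; set Q := _ `^ (- k) in h2 Q0 *.
set E := expR (- (l * rho)) in h3 E0 *; set F := expR (- (l * (rho * v))) in h4 *.
clearbody P Q E F; case/andP: E0 => E0 E1; case/andP: Q0 => Q0 Q1.
(* Both [Q] and [E] lie in [0, 1], so the distance of the products is at most |P - E| + |Q - F|. *)
rewrite (_ : P * Q - E * F = (P - E) * Q + E * (Q - F)); last by ring.
rewrite (le_trans (ler_normD _ _)) // !normrM (ger0_norm Q0) (ger0_norm E0).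
have d1 : `|P - E| <= 8 / m + `|l - n| / m.
  by rewrite (le_trans (ler_distD (expR (- (n * rho))) _ _)) // lerD // distrC.
have d2 : `|Q - F| <= 8 / m + `|l - k| / m.
  by rewrite (le_trans (ler_distD (expR (- (k * (rho * v)))) _ _)) // lerD // distrC.
apply: le_trans (_ : `|P - E| + `|Q - F| <= _).
  by rewrite lerD // ?ler_piMr ?ler_piMl.
by apply: le_trans (lerD d1 d2) _; lra.
Qed.

(** * Gaussian kernels *)

Lemma sqr_euclidean_norm (R : realType) (d : nat) (h : 'rV[R]_d) :
  euclidean_norm h ^+ 2 = \sum_(i < d) h 0 i ^+ 2.
Proof. by rewrite sqr_sqrtr // sumr_ge0 // => i _; exact: sqr_ge0. Qed.

(** Induction on [m]: one inner product is expanded over the coordinates and s_i(k) is absorbed into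
    the weight w_i. For m = 0 the form is the square of the sum of the weights. *)
Lemma gram_power_psd (R : realType) (d n m : nat) (s : 'I_n -> 'rV[R]_d)
  (w : 'I_n -> R) :
  0 <= \sum_(i < n) \sum_(j < n) w i * w j * (\sum_(k < d) s i 0 k * s j 0 k) ^+ m.
Proof.
elim: m w => [|m ih] w.
  rewrite (_ : \sum_(i < n) _ = (\sum_(i < n) w i) ^+ 2) ?sqr_ge0 // expr2 mulr_suml.
  by apply: eq_bigr => i _; rewrite mulr_sumr; apply: eq_bigr => j _; rewrite mulr1.
rewrite (_ : \sum_(i < n) _ = \sum_(k < d) \sum_(i < n) \sum_(j < n)
    (w i * s i 0 k) * (w j * s j 0 k) * (\sum_(l < d) s i 0 l * s j 0 l) ^+ m).
  by apply: sumr_ge0 => k _; exact: (ih (fun i => w i * s i 0 k)).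
rewrite [RHS]exchange_big; apply: eq_bigr => i _ /=; rewrite [RHS]exchange_big.
apply: eq_bigr => j _ /=; rewrite exprS mulrA mulr_sumr mulr_suml.
by apply: eq_bigr => k _; ring.
Qed.

(** The partial sums of the exponential series are combinations of powers of the Gram matrix with
    coefficients c^m/m! >= 0, and nonnegativity passes to the limit. *)
Lemma exp_gram_psd (R : realType) (d n : nat) (s : 'I_n -> 'rV[R]_d)
  (w : 'I_n -> R) (c : R) : 0 <= c ->
  0 <= \sum_(i < n) \sum_(j < n) w i * w j * expR (c * \sum_(k < d) s i 0 k * s j 0 k).
Proof.
move=> c0.
pose t i j := c * \sum_(k < d) s i 0 k * s j 0 k.
have cv : (fun N => \sum_(i < n) \sum_(j < n) w i * w j * series (exp_coeff (t i j)) N)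
    @ \oo --> \sum_(i < n) \sum_(j < n) w i * w j * expR (t i j).
  apply: cvg_big => [|i _]; first exact: add_continuous.
  apply: cvg_big => [|j _]; first exact: add_continuous.
  apply: cvgMr.
  exact: is_cvg_series_exp_coeff.
apply: (cvgr_to_ge cv); apply: nearW => N.
rewrite (_ : \sum_(i < n) _ = \sum_(0 <= m < N) c ^+ m / m`!%:R * (\sum_(i < n) \sum_(j < n)
   w i * w j * (\sum_(k < d) s i 0 k * s j 0 k) ^+ m)).
  apply: sumr_ge0 => m _; rewrite mulr_ge0 ?divr_ge0 ?exprn_ge0 //.
  exact: gram_power_psd.
under [RHS]eq_bigr do rewrite mulr_sumr.
rewrite [RHS]exchange_big; apply: eq_bigr => i _ /=.
under [RHS]eq_bigr do rewrite mulr_sumr.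
rewrite [RHS]exchange_big; apply: eq_bigr => j _ /=.
rewrite /series /= mulr_sumr; apply: eq_bigr => m _.
by rewrite /exp_coeff /= /t exprMn; ring.
Qed.

(** Expand |x-y|^2 = |x|^2 + |y|^2 - 2<x,y>: the factors e^(-c|s_i|^2) go into the weights, leaving
    [exp_gram_psd] with constant 2c. *)
Lemma gaussian_psd (R : realType) (d n : nat) (s : 'I_n -> 'rV[R]_d)
  (w : 'I_n -> R) (c : R) : 0 <= c ->
  0 <= \sum_(i < n) \sum_(j < n) w i * w j * expR (- (c * euclidean_norm (s i - s j) ^+ 2)).
Proof.
move=> c0; pose q (x : 'rV[R]_d) := \sum_(k < d) x 0 k ^+ 2.
have := exp_gram_psd R d n s (fun i => w i * expR (- (c * q (s i)))) (2 * c)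
  (mulr_ge0 (ler0n R 2) c0).
congr (0 <= _); apply: eq_bigr => i _; apply: eq_bigr => j _.
rewrite [LHS](_ : _ = w i * w j * (expR (- (c * q (s i))) * expR (- (c * q (s j))) *
   expR (2 * c * \sum_(k < d) s i 0 k * s j 0 k))); last by ring.
rewrite -!expRD; congr (_ * expR _); rewrite sqr_euclidean_norm.
rewrite (_ : \sum_(k < d) (s i - s j) 0 k ^+ 2 =
  q (s i) + q (s j) - 2 * \sum_(k < d) s i 0 k * s j 0 k).
  by ring.
rewrite /q mulr_sumr -sumrN -!big_split /=; apply: eq_bigr => k _.
by rewrite !mxE; ring.
Qed.

(** * Mixtures with a beta weight *)

(** The unnormalised beta prime density with parameters [s] and [p - s]. *)
Definition beta_weight (R : realType) (s p v : R) : R := v `^ (s - 1) * (1 + v) `^ (- p).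

Definition beta_mixture (R : realType) (s p : R) (phi : R -> R) : R :=
  \int[@lebesgue_measure R]_(v in `]0, +oo[) (beta_weight R s p v * phi v).

Lemma beta_weight_ge0 (R : realType) (s p v : R) : 0 <= beta_weight R s p v.
Proof. by rewrite mulr_ge0 ?powR_ge0. Qed.

Lemma measurable_beta_weight (R : realType) (s p : R) :
  measurable_fun setT (beta_weight R s p).
Proof. by rewrite /beta_weight; prove_measurable. Qed.

Lemma int_pos_beta_weight (R : realType) (s p : R) : 0 < s -> s < p ->
  int_pos R (fun v => (beta_weight R s p v)%:E) = (Gamma (p - s) * Gamma s / Gamma p)%:E.
Proof.
move=> s0 sp; have := Beta_integral R (p - s) s; rewrite subr_gt0 subrK.
by apply.
Qed.

Lemma integrable_beta_mixture (R : realType) (s p : R) (phi : R -> R) :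
  0 < s -> s < p -> measurable_fun setT phi ->
  (forall v, 0 < v -> `|phi v| <= 1) ->
  (@lebesgue_measure R).-integrable `]0, +oo[
    (EFin \o (fun v => beta_weight R s p v * phi v)).
Proof.
move=> s0 sp mphi phi1.
have iw : (@lebesgue_measure R).-integrable `]0, +oo[ (EFin \o beta_weight R s p).
  apply/integrableP; split.
    by apply: measurable_funTS; apply/measurable_EFinP; exact: measurable_beta_weight.
  rewrite (_ : integral _ _ _ = int_pos R (fun v => (beta_weight R s p v)%:E)).
    by rewrite int_pos_beta_weight // ltry.
  by apply: eq_int_pos => v _ /=; rewrite ger0_norm // beta_weight_ge0.
apply: le_integrable iw; first exact: measurable_itv.
  apply: measurable_funTS; apply/measurable_EFinP.
  by apply: measurable_funM => //; exact: measurable_beta_weight.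
move=> v /=; rewrite in_itv/= andbT => v0.
by rewrite lee_fin normrM ler_piMr // phi1.
Qed.

Lemma beta_mixture1 (R : realType) (s p : R) : 0 < s -> s < p ->
  beta_mixture R s p (fun=> 1) = Gamma (p - s) * Gamma s / Gamma p.
Proof.
move=> s0 sp; rewrite -[RHS]/(fine _%:E) -int_pos_beta_weight //.
by congr fine; apply: eq_int_pos => v _; rewrite mulr1.
Qed.

(** A bound on the factors that is uniform in [v] is integrated against the weight, whose total mass
    appears on the right. *)
Lemma dist_beta_mixture (R : realType) (s p e : R) (phi psi : R -> R) :
  0 < s -> s < p -> measurable_fun setT phi -> measurable_fun setT psi ->
  (forall v, 0 < v -> 0 <= phi v <= 1) -> (forall v, 0 < v -> 0 <= psi v <= 1) ->
  (forall v, 0 < v -> `|phi v - psi v| <= e) ->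
  `|beta_mixture R s p phi - beta_mixture R s p psi| <=
    e * (Gamma (p - s) * Gamma s / Gamma p).
Proof.
move=> s0 sp mphi mpsi phi1 psi1 d.
have n1 (f : R -> R) : (forall v, 0 < v -> 0 <= f v <= 1) ->
    forall v, 0 < v -> `|f v| <= 1.
  by move=> f1 v /f1 /andP[f0 ?]; rewrite ger0_norm.
have i1 := integrable_beta_mixture _ _ _ _ s0 sp mphi (n1 _ phi1).
have i2 := integrable_beta_mixture _ _ _ _ s0 sp mpsi (n1 _ psi1).
have i0 : (@lebesgue_measure R).-integrable `]0, +oo[
    (EFin \o (fun v => beta_weight R s p v * 1)).
  by apply: integrable_beta_mixture => // v _; rewrite normr1.
rewrite -beta_mixture1 // /beta_mixture -RintegralB //.
have i3 : (@lebesgue_measure R).-integrable `]0, +oo[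
    (EFin \o (fun v => beta_weight R s p v * phi v - beta_weight R s p v * psi v)).
  by apply: (integrableB _ i1 i2); exact: measurable_itv.
rewrite (le_trans (le_normr_Rintegral _ i3)) // -RintegralZl //.
apply: le_Rintegral => //.
- exact: integrable_norm.
- by apply: (integrableZl _ e i0); exact: measurable_itv.
move=> v /=; rewrite in_itv/= andbT => v0.
rewrite mulr1 -mulrBr normrM ger0_norm ?beta_weight_ge0 // mulrC.
by rewrite ler_wpM2r ?beta_weight_ge0 // d.
Qed.

(** * Both kernels as mixtures *)

(** Substitute u = 1 + v in the Laguerre integral. *)
Lemma laguerre_kernelE (R : realType) (d : nat) (b alpha beta : R) (h : 'rV[R]_d) :
  laguerre_kernel b alpha beta h =
  Gamma (beta - d%:R / 2) / Gamma (alpha - d%:R / 2) / Gamma (beta - alpha) *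
  beta_mixture R (beta - alpha) (beta - d%:R / 2)
    (fun v => expR (- ((1 + v) * (euclidean_norm h ^+ 2 / b ^+ 2)))).
Proof.
rewrite /laguerre_kernel /laguerre_second_kind mulrA.
set x := euclidean_norm h ^+ 2 / b ^+ 2.
set d2 := d%:R / 2.
have -> : d2 - alpha + 1 - (d2 - beta + 1) = beta - alpha by ring.
congr (_ * _); rewrite /beta_mixture /Rintegral; congr fine.
rewrite (ge0_integral_shift _ (fun u =>
  (expR (- (u * x)) * u `^ (d2 - beta + 1 - 1) * (u - 1) `^ (beta - alpha - 1))%:E)).
- apply: eq_int_pos => v v0; congr EFin.
  rewrite /beta_weight opprB (_ : d2 - beta + 1 - 1 = d2 - beta); last by ring.
  by rewrite (_ : 1 + v - 1 = v); ring.
- by apply: measurable_funTS; prove_measurable.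
- by move=> u _; rewrite lee_fin !mulr_ge0 ?powR_ge0 ?expR_ge0.
Qed.

(** Euler's integral carries the constant Gamma(beta-alpha) Gamma(gamma-d/2) /
    Gamma(beta-alpha+gamma-d/2). Against the prefactor of the covariance this leaves a constant free
    of [gamma], the same as for the Laguerre kernel. *)
Lemma gauss_hypergeometric_covarianceE (R : realType) (d : nat)
  (a alpha beta gamma : R) (h : 'rV[R]_d) :
  d%:R / 2 < alpha -> alpha < beta -> alpha < gamma ->
  let x := Num.max (1 - euclidean_norm h ^+ 2 / a ^+ 2) 0 in
  gauss_hypergeometric_covariance a alpha beta gamma h =
  Gamma (beta - d%:R / 2) / Gamma (alpha - d%:R / 2) / Gamma (beta - alpha) *
  beta_mixture R (beta - alpha) (beta - d%:R / 2)
    (fun v => x `^ (beta - alpha + gamma - d%:R / 2 - 1)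
              * (1 + (1 - x) * v) `^ (- (gamma - alpha))).
Proof.
set d2 := d%:R / 2 => da ab ag x.
have s0 : 0 < beta - alpha by rewrite subr_gt0.
have n0 : 0 < beta - alpha + gamma - d2 by lra.
have x01 : 0 <= x <= 1.
  rewrite le_max lexx orbT /= ge_max ler01 andbT lerBlDr lerDl.
  by rewrite divr_ge0 ?sqr_ge0.
have := @hypergeometric_2F1_integral R (beta - alpha) (gamma - alpha)
  (beta - alpha + gamma - d2) x s0 _ _ x01 _.
(* The convergence condition a + b < c of the Gauss series reads d/2 < alpha here. *)
move=> /(_ ltac:(lra) ltac:(lra) ltac:(lra)).
have -> : beta - alpha + gamma - d2 - (beta - alpha) = gamma - d2 by ring.
have -> : gamma - alpha - (beta - alpha + gamma - d2) = - (beta - d2) by ring.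
rewrite /gauss_hypergeometric_covariance -/d2 -/x.
set n := beta - alpha + gamma - d2; set F := hypergeometric_2F1 _ _ _ _ => E.
have -> : beta_mixture R (beta - alpha) (beta - d2)
    (fun v => x `^ (n - 1) * (1 + (1 - x) * v) `^ (- (gamma - alpha))) =
  x `^ (n - 1) * (Gamma (beta - alpha) * Gamma (gamma - d2) / Gamma n * F).
  rewrite -[RHS]/(fine _%:E) EFinM -E -int_posZl; last 3 first.
  - by prove_measurable.
  - by move=> v _; rewrite lee_fin !mulr_ge0 ?powR_ge0.
  - by rewrite lee_fin powR_ge0.
  congr fine; apply: eq_int_pos => v v0; rewrite -EFinM; congr EFin.
  by rewrite /beta_weight; ring.
have g1 : Gamma (beta - alpha) != 0 by rewrite gt_eqF ?Gamma_gt0.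
have g2 : Gamma n != 0 by rewrite gt_eqF ?Gamma_gt0.
have g3 : Gamma (alpha - d2) != 0 by rewrite gt_eqF ?Gamma_gt0 ?subr_gt0.
clear E; move: (x `^ (n - 1)) F => X F.
set G1 := Gamma (beta - alpha) in g1 *; set G2 := Gamma n in g2 *.
set G3 := Gamma (alpha - d2) in g3 *; set G4 := Gamma (beta - d2).
set G5 := Gamma (gamma - d2); clearbody G1 G2 G3 G4 G5.
by field; rewrite g1 g2 g3.
Qed.

(** * Positive semidefiniteness of the limit kernel *)

Lemma Rintegral_sum (R : realType) (I : Type) (r : seq I) (D : set R) (f : I -> R -> R) :
  measurable D ->
  (forall i, (@lebesgue_measure R).-integrable D (EFin \o f i)) ->
  \int[@lebesgue_measure R]_(x in D) (\sum_(i <- r) f i x) =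
  \sum_(i <- r) \int[@lebesgue_measure R]_(x in D) f i x.
Proof.
move=> mD fi; elim: r => [|i r ih].
  rewrite big_nil (@eq_Rintegral _ _ _ _ _ (fun=> 0)) => [|x _]; last by rewrite big_nil.
  by rewrite Rintegral_cst // mul0r.
rewrite big_cons -ih -RintegralD //.
  by apply: eq_Rintegral => x _; rewrite big_cons.
rewrite (_ : _ \o _ = (fun x => \sum_(j <- r) (f j x)%:E)%E).
  by apply: integrable_sum => // j _; exact: fi.
by apply/funext => x; rewrite /= sumEFin.
Qed.

(** The quadratic form is moved under the integral; for each [v] it is a nonnegative weight times
    the form of the Gaussian kernel with constant (1+v)/b^2. *)
Lemma covariance_kernel_laguerre (R : realType) (d : nat) (b alpha beta : R) :
  d%:R / 2 < alpha -> alpha < beta ->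
  covariance_kernel (@laguerre_kernel R d b alpha beta).
Proof.
set d2 := d%:R / 2 => da ab; split=> [h|n s w].
  rewrite /laguerre_kernel (_ : euclidean_norm (- h) = euclidean_norm h) //.
  by congr Num.sqrt; apply: eq_bigr => i _; rewrite mxE sqrrN.
have s0 : 0 < beta - alpha by rewrite subr_gt0.
have p0 : beta - alpha < beta - d2 by lra.
pose phi (h : 'rV[R]_d) v := expR (- ((1 + v) * (euclidean_norm h ^+ 2 / b ^+ 2))).
have iphi h : (@lebesgue_measure R).-integrable `]0, +oo[
    (EFin \o (fun v => beta_weight R (beta - alpha) (beta - d2) v * phi h v)).
  apply: integrable_beta_mixture => //; first by rewrite /phi; prove_measurable.
  move=> v v0; rewrite ger0_norm ?expR_ge0 // expR_le1 oppr_le0.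
  by rewrite mulr_ge0 ?divr_ge0 ?sqr_ge0 // addr_ge0 // ltW.
set k := Gamma (beta - d2) / Gamma (alpha - d2) / Gamma (beta - alpha).
have k0 : 0 <= k.
  by rewrite !divr_ge0 // ltW // Gamma_gt0 ?subr_gt0 // (lt_trans da).
rewrite (_ : \sum_(i < n) _ = k * \int[@lebesgue_measure R]_(v in `]0, +oo[)
    \sum_(i < n) \sum_(j < n) w i * w j *
      (beta_weight R (beta - alpha) (beta - d2) v * phi (s i - s j) v)).
  rewrite mulr_ge0 // Rintegral_ge0 // => v /=; rewrite in_itv/= andbT => v0.
  rewrite (_ : \sum_(i < n) _ = beta_weight R (beta - alpha) (beta - d2) v *
     \sum_(i < n) \sum_(j < n) w i * w j *
       expR (- ((1 + v) / b ^+ 2 * euclidean_norm (s i - s j) ^+ 2))).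
    rewrite mulr_ge0 ?beta_weight_ge0 // gaussian_psd //.
    by rewrite divr_ge0 ?sqr_ge0 // addr_ge0 // ltW.
  rewrite mulr_sumr; apply: eq_bigr => i _; rewrite mulr_sumr; apply: eq_bigr => j _.
  by rewrite /phi mulrCA; congr (_ * (_ * expR (- _))); ring.
have iw i j : (@lebesgue_measure R).-integrable `]0, +oo[ (EFin \o (fun v =>
    w i * w j * (beta_weight R (beta - alpha) (beta - d2) v * phi (s i - s j) v))).
  by apply: (integrableZl _ (w i * w j) (iphi (s i - s j))); exact: measurable_itv.
under [in RHS]eq_Rintegral do rewrite pair_bigA.
rewrite Rintegral_sum //= pair_bigA mulr_sumr; apply: eq_bigr => -[i j] _ /=.
rewrite laguerre_kernelE -/d2 -/k RintegralZl; [|exact: measurable_itv|exact: iphi].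
by rewrite mulrCA.
Qed.

(** * Uniform convergence *)

(** [dist_mixture_factor] is applied with l = (a/b)^2 and rho = |h|^2/a^2, so that l rho =
    |h|^2/b^2. The right side is free of [h]. *)
Lemma dist_gauss_laguerre (R : realType) (d : nat) (m a b alpha beta gamma : R)
  (h : 'rV[R]_d) :
  d%:R / 2 < alpha -> alpha < beta -> 0 < a -> 0 < b -> 0 < m ->
  m <= (a / b) ^+ 2 -> m <= beta - alpha + gamma - d%:R / 2 - 1 ->
  m <= gamma - alpha ->
  `|gauss_hypergeometric_covariance a alpha beta gamma h - laguerre_kernel b alpha beta h|
  <= (16 + `|(a / b) ^+ 2 - (beta - alpha + gamma - d%:R / 2 - 1)|
         + `|(a / b) ^+ 2 - (gamma - alpha)|) / m.
Proof.
set d2 := d%:R / 2 => da ab a0 b0 m0 ml mn mg.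
have ag : alpha < gamma by rewrite -subr_gt0 (lt_le_trans m0).
have s0 : 0 < beta - alpha by rewrite subr_gt0.
have p0 : beta - alpha < beta - d2 by lra.
rewrite gauss_hypergeometric_covarianceE // laguerre_kernelE -/d2.
set n := beta - alpha + gamma - d2 - 1 in mn *.
set k := Gamma (beta - d2) / Gamma (alpha - d2) / Gamma (beta - alpha).
set e := _ / m.
set rho := euclidean_norm h ^+ 2 / a ^+ 2.
have rho0 : 0 <= rho by rewrite divr_ge0 ?sqr_ge0.
have -> : euclidean_norm h ^+ 2 / b ^+ 2 = (a / b) ^+ 2 * rho.
  by rewrite /rho; field; rewrite !gt_eqF.
set x := Num.max (1 - rho) 0.
have x01 : 0 <= x <= 1.
  by rewrite le_max lexx orbT /= ge_max ler01 andbT lerBlDr lerDl.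
case/andP: (x01) => x0 x1.
pose w := Gamma (beta - d2 - (beta - alpha)) * Gamma (beta - alpha)
  / Gamma (beta - d2).
(* The normalised weight has mass 1, so the bound on the factors passes to the mixtures
   unchanged. *)
have kw : k * w = 1.
  have g1 : Gamma (beta - alpha) != 0 by rewrite gt_eqF ?Gamma_gt0.
  have g2 : Gamma (beta - d2) != 0 by rewrite gt_eqF ?Gamma_gt0 // (lt_trans s0).
  have g3 : Gamma (alpha - d2) != 0 by rewrite gt_eqF ?Gamma_gt0 ?subr_gt0.
  rewrite /k /w (_ : beta - d2 - (beta - alpha) = alpha - d2); last by ring.
  set G1 := Gamma _ in g1 *; set G2 := Gamma (beta - d2) in g2 *.
  set G3 := Gamma _ in g3 *; clearbody G1 G2 G3.
  by field; rewrite g1 g2 g3.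
have k0 : 0 <= k.
  by rewrite !divr_ge0 // ltW // Gamma_gt0 ?subr_gt0 // (lt_trans da).
rewrite -mulrBr normrM (ger0_norm k0).
apply: (@le_trans _ _ (k * (e * w))); last by rewrite mulrCA kw mulr1.
rewrite ler_wpM2l //; apply: dist_beta_mixture => //.
- by prove_measurable.
- by prove_measurable.
- move=> v v0; rewrite mulr_ge0 ?powR_ge0 //= mulr_ile1 ?powR_ge0 //.
    have := ge0_ler_powR (ltW (lt_le_trans m0 mn))
      (x0 : x \is Num.nneg) (ler01 : 1 \is Num.nneg) x1.
    by rewrite powR1.
  have w1 : 1 <= 1 + (1 - x) * v by rewrite lerDl mulr_ge0 ?subr_ge0 // ltW.
  have := ler_powR w1 (ltW (lt_le_trans m0 mg)); rewrite powRr0 => wg.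
  by rewrite powRN invf_le1 // (lt_le_trans ltr01).
- move=> v v0; rewrite expR_ge0 expR_le1 oppr_le0.
  by rewrite mulr_ge0 ?(mulr_ge0 (sqr_ge0 _) rho0) // addr_ge0 // ltW.
- by move=> v v0; apply: dist_mixture_factor => //; exact: ltW.
Qed.

(** The Gamma factors, the exponent and the Gauss series are all symmetric in [beta] and [gamma].
    This reduces the interchanged statement to the first one. *)
Lemma gauss_hypergeometric_covariance_sym (R : realType) (d : nat)
  (a alpha beta gamma : R) (h : 'rV[R]_d) :
  gauss_hypergeometric_covariance a alpha beta gamma h =
  gauss_hypergeometric_covariance a alpha gamma beta h.
Proof.
rewrite /gauss_hypergeometric_covariance.
have -> : gamma - alpha + beta - d%:R / 2 = beta - alpha + gamma - d%:R / 2 by ring.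
rewrite [X in X / _ * _ * _]mulrC; congr (_ * _); rewrite /hypergeometric_2F1.
by congr (limn (series _)); apply/funext => n; rewrite [X in X / _ * _]mulrC.
Qed.

Lemma gauss_hypergeometric_covariance_cvg (R : realType) (d : nat) (alpha beta b : R)
  (T : Type) (F : set_system T) (a gamma : T -> R) :
  Filter F -> d%:R / 2 < alpha -> alpha < beta -> 0 < b ->
  a t @[t --> F] --> +oo -> gamma t @[t --> F] --> +oo ->
  (a t / Num.sqrt (gamma t)) @[t --> F] --> b ->
  {uniform,
    (fun t => @gauss_hypergeometric_covariance R d (a t) alpha beta (gamma t)) @ F
    --> @laguerre_kernel R d b alpha beta}.
Proof.
move=> FF da ab b0 ay gy agb.
(* The two exponents of the mixture are [gamma] plus constants, and [c] is the sum of the absolute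
   values of these constants. *)
set d2 := d%:R / 2 in da *; pose c := `|beta - alpha - d2 - 1| + `|alpha|.
have lam : ((a t / b) ^+ 2 / gamma t) @[t --> F] --> (1 : R).
  have : ((a t / Num.sqrt (gamma t)) ^+ 2 * (b ^+ 2)^-1) @[t --> F] --> b ^+ 2 * (b ^+ 2)^-1.
    by apply: cvgMl; rewrite !expr2; apply: cvgM.
  rewrite mulfV ?sqrf_eq0 ?gt_eqF //; apply: cvg_trans; apply: near_eq_cvg.
  near=> t; have g0 : 0 < gamma t by near: t; move/cvgryPgt: gy; exact.
  by rewrite !exprMn !exprVn sqr_sqrtr ?(ltW g0) // mulrAC.
(* A neighbourhood in the uniform topology is reduced to a bound [e] that holds eventually, for all
   [h] at once. *)
move=> P /uniform_nbhs [E [+ EP]]; rewrite -entourage_ballE => -[e /= e0 eE].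
suff : \forall t \near F, forall h, ball (laguerre_kernel b alpha beta h) e
    (@gauss_hypergeometric_covariance R d (a t) alpha beta (gamma t) h).
  by apply: filterS => t Et; apply: EP => h _; apply: eE; exact: Et.
near=> t => h.
have a0 : 0 < a t by near: t; move/cvgryPgt: ay; exact.
have g0 : 0 < gamma t by near: t; move/cvgryPgt: gy; exact.
(* With m = gamma/2, [gc] and [l1] give the three lower bounds by [m]. The error is at most (16 + c
   + 2|l - gamma|) / m, where [ge] makes the part 16 + c contribute at most e/4 and [l2] does the
   same for the rest. *)
have gc : 2 * c + 2 <= gamma t by near: t; move/cvgryPge: gy; exact.
have ge : 8 * (16 + c) / e <= gamma t by near: t; move/cvgryPge: gy; exact.
have l1 : `|1 - (a t / b) ^+ 2 / gamma t| <= 2^-1.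
  by near: t; move/cvgrPdist_le: lam; apply; rewrite invr_gt0.
have l2 : `|1 - (a t / b) ^+ 2 / gamma t| <= e / 16.
  by near: t; move/cvgrPdist_le: lam; apply; rewrite divr_gt0.
rewrite /ball /= distrC.
set l := (a t / b) ^+ 2 in l1 l2 *; set g := gamma t in g0 gc ge l1 l2 *.
have lg : `|l - g| = `|1 - l / g| * g.
  rewrite -[X in _ = _ * X](ger0_norm (ltW g0)) -normrM distrC mulrBl mul1r.
  by rewrite divfK // gt_eqF.
have {l1}l1 : `|l - g| <= g / 2 by rewrite lg mulrC ler_wpM2l // ltW.
have {l2}l2 : `|l - g| <= g * (e / 16) by rewrite lg mulrC ler_wpM2l // ltW.
have m0 : 0 < g / 2 by rewrite divr_gt0.
have c1 : `|beta - alpha - d2 - 1| <= c by rewrite lerDl.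
have c2 : `|alpha| <= c by rewrite lerDr.
move: (c1) (c2) (l1); rewrite !ler_norml => /andP[c11 c12] /andP[c21 c22] /andP[l11 l12].
have ml : g / 2 <= l by lra.
have mn : g / 2 <= beta - alpha + g - d2 - 1 by lra.
have mg : g / 2 <= g - alpha by lra.
apply: le_lt_trans (dist_gauss_laguerre R d _ _ _ _ _ _ h da ab a0 b0 m0 ml mn mg) _.
rewrite -/l -/d2 ltr_pdivrMr //.
have t1 : `|l - (beta - alpha + g - d2 - 1)| <= `|l - g| + `|beta - alpha - d2 - 1|.
  by rewrite (_ : l - _ = (l - g) - (beta - alpha - d2 - 1)) ?ler_normB //; ring.
have t2 : `|l - (g - alpha)| <= `|l - g| + `|alpha|.
  by rewrite (_ : l - _ = (l - g) + alpha) ?ler_normD //; ring.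
have cE : c = `|beta - alpha - d2 - 1| + `|alpha| by [].
move: ge; rewrite ler_pdivrMr // => ge.
have := normr_ge0 alpha; have := normr_ge0 (beta - alpha - d2 - 1).
have : 0 < g * e by rewrite mulr_gt0.
lra.
Unshelve. all: by end_near. Qed.

Theorem theorem12 (R : realType) (d : nat) (alpha b : R)
  (d_ge1 : (1 <= d)%N) (alpha_gt : d%:R / 2 < alpha) (b_gt0 : 0 < b) :
  (forall beta : R, alpha < beta ->
     covariance_kernel (@laguerre_kernel R d b alpha beta) /\
     forall (T : Type) (F : set_system T) (a gamma : T -> R), Filter F ->
       a t @[t --> F] --> +oo ->
       gamma t @[t --> F] --> +oo ->
       (a t / Num.sqrt (gamma t)) @[t --> F] --> b ->
       {uniform,
         (fun t => @gauss_hypergeometric_covariance R d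
                     (a t) alpha beta (gamma t)) @ F
         --> @laguerre_kernel R d b alpha beta})
  /\
  (forall gamma : R, alpha < gamma ->
     covariance_kernel (@laguerre_kernel R d b alpha gamma) /\
     forall (T : Type) (F : set_system T) (a beta : T -> R), Filter F ->
       a t @[t --> F] --> +oo ->
       beta t @[t --> F] --> +oo ->
       (a t / Num.sqrt (beta t)) @[t --> F] --> b ->
       {uniform,
         (fun t => @gauss_hypergeometric_covariance R d
                     (a t) alpha (beta t) gamma) @ F
         --> @laguerre_kernel R d b alpha gamma}).
Proof.
split=> [beta ab|gamma ag].
  split; first exact: covariance_kernel_laguerre.
  by move=> T F a gamma FF; exact: gauss_hypergeometric_covariance_cvg.
split; first exact: covariance_kernel_laguerre.
move=> T F a beta FF ay by_ abb.
have E : (fun t => @gauss_hypergeometric_covariance R d (a t) alpha (beta t) gamma) =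
    (fun t => @gauss_hypergeometric_covariance R d (a t) alpha gamma (beta t)).
  apply/funext => t; apply/funext => h.
  exact: gauss_hypergeometric_covariance_sym.
by rewrite E; exact: gauss_hypergeometric_covariance_cvg.
Qed.
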